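(* The set of patterns $\{1324, 3416725\}$ is Wilf-equivalent to the pattern $1234$; that is, for every $n \in \mathbb{N}$, the number of permutations of $\{1,\dots,n\}$ avoiding both $1324$ and $3416725$ equals the number of permutations of $\{1,\dots,n\}$ avoiding $1234$.
   Context: A permutation $\pi$ contains a pattern $\sigma$ (itself a permutation) if $\pi$ has a subsequence order-isomorphic to $\sigma$; otherwise $\pi$ avoids $\sigma$. Two sets of patterns are Wilf-equivalent if, for every $n$, they are avoided by the same number of permutations of length $n$. *)

(* Defs.v *)
From mathcomp Require Import all_boot all_fingroup.
Set Implicit Arguments.
Unset Strict Implicit.
Unset Printing Implicit Defensive.

(* Permutations of {1, ..., n} are elements of 'S_n, positions and values     *)
(* being shifted down to {0, ..., n-1}.                                       *)

(* [f] selects the positions of a subsequence of [p] order-isomorphic to [s]. *)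
Definition occurrence n k (p : 'S_n) (s : 'S_k) (f : {ffun 'I_k -> 'I_n}) : bool :=
  [forall i : 'I_k, forall j : 'I_k, (i < j) ==> (f i < f j)] &&
  [forall i : 'I_k, forall j : 'I_k, (p (f i) < p (f j)) == (s i < s j)].

Definition contains n k (p : 'S_n) (s : 'S_k) : bool :=
  [exists f : {ffun 'I_k -> 'I_n}, occurrence p s f].

Definition avoids n k (p : 'S_n) (s : 'S_k) : bool := ~~ contains p s.

Definition pattern := {k : nat & 'S_k}.

Definition Pattern k (s : 'S_k) : pattern := existT (fun m => 'S_m) k s.

(* Finite sets of patterns are given by listing their elements. *)
Definition avoiders n (B : seq pattern) : {set 'S_n} :=
  [set p : 'S_n | all (fun s : pattern => avoids p (projT2 s)) B].

Definition wilf_equivalent (B C : seq pattern) : Prop :=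
  forall n : nat, #|avoiders n B| = #|avoiders n C|.

Definition one_line n (p : 'S_n) : seq nat := [seq (p i).+1 | i <- enum 'I_n].

Definition word_fun k (w : seq nat) (i : 'I_k.+1) : 'I_k.+1 :=
  inord (nth 0 w i).-1.

Lemma word_fun_inj k (w : seq nat) :
  perm_eq w (iota 1 k.+1) -> injective (@word_fun k w).
Proof.
move=> w_perm; have sz_w : size w = k.+1 by rewrite (perm_size w_perm) size_iota.
have w_uniq : uniq w by rewrite (perm_uniq w_perm) iota_uniq.
have bnd (i : 'I_k.+1) : 0 < nth 0 w i < k.+2.
  have := mem_nth 0 (_ : i < size w); rewrite sz_w => /(_ (ltn_ord i)).
  by rewrite (perm_mem w_perm) mem_iota add1n.
move=> i j /(congr1 val); have /andP[i0 ik] := bnd i; have /andP[j0 jk] := bnd j.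
rewrite /= !inordK; last 2 first; try by rewrite -ltnS prednK.
move=> /(congr1 S); rewrite !prednK // => /eqP.
by rewrite nth_uniq ?sz_w ?ltn_ord // => /eqP /val_inj.
Qed.

(* The permutation of {1, ..., k+1} with one-line notation [w]. *)
Definition word_perm k (w : seq nat) (w_perm : perm_eq w (iota 1 k.+1)) : 'S_k.+1 :=
  perm (word_fun_inj w_perm).

Lemma one_line_word_perm k (w : seq nat) (w_perm : perm_eq w (iota 1 k.+1)) :
  one_line (word_perm w_perm) = w.
Proof.
have sz_w : size w = k.+1 by rewrite (perm_size w_perm) size_iota.
apply: (@eq_from_nth _ 0); first by rewrite size_map size_enum_ord sz_w.
move=> i; rewrite size_map size_enum_ord => lt_ik.
rewrite (nth_map ord0) ?size_enum_ord // permE /word_fun nth_enum_ord //.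
have := mem_nth 0 (_ : i < size w); rewrite sz_w => /(_ lt_ik).
rewrite (perm_mem w_perm) mem_iota add1n => /andP[i0 ik].
by rewrite inordK prednK.
Qed.

Definition p1234 : 'S_4 := @word_perm 3 [:: 1; 2; 3; 4] isT.
Definition p1324 : 'S_4 := @word_perm 3 [:: 1; 3; 2; 4] isT.
Definition p3416725 : 'S_7 := @word_perm 6 [:: 3; 4; 1; 6; 7; 2; 5] isT.

(* Main.v *)
(* The positions and values of the left-to-right minima and right-to-left     *)
(* maxima of a permutation form its frame. Every frame contains exactly one   *)
(* permutation avoiding 1234 and exactly one avoiding 1324 and 3416725.       *)
(* Existence: exchanging the two middle entries of a 1234 or a 1324, or       *)
(* turning a 3416725 into a 3612745, keeps the frame, and it moves the        *)
(* smallest displaced value to the right in the first case and to the left in *)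
(* the others, so extremal elements of a frame for the lexicographic order on *)
(* inverses are avoiders.                                                     *)
(* Uniqueness: let p and t have the same frame and let v be the least value   *)
(* with different positions, at y in t and at x > y in p. Then t contains a   *)
(* 1234 with 2 and 3 at y and x. Some value u > v sits at a position >= x in  *)
(* t but before x in p. If p avoids 1324, then in p the value u lies before   *)
(* y and, with v playing the role of 2 and p(y) that of 6, is the 4 of a      *)
(* 3416725.                                                                   *)
Require Import Defs.
From mathcomp Require Import all_boot all_fingroup.
From mathcomp Require Import zify.
Set Implicit Arguments.
Unset Strict Implicit.
Unset Printing Implicit Defensive.

(** Both avoidance classes are transversals of the fibres of [frame], so each has as many elements
    as there are frames ([card_frame_transversal]). Two permutations share a frame exactly when
    every position where they differ has a lower entry to its left and a higher one to its right,
    bounding both values ([eq_frame], [frame_sandwich]); existence and uniqueness rest on this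
    criterion. *)

Lemma word_perm_val k (w : seq nat) (w_perm : perm_eq w (iota 1 k.+1)) i :
  word_perm w_perm i = (nth 0 w i).-1 :> nat.
Proof.
have := congr1 (fun s => nth 0 s i) (one_line_word_perm w_perm).
by rewrite /one_line (nth_map ord0) ?size_enum_ord // nth_ord_enum => <-.
Qed.

Lemma contains_wordP n k (w : seq nat) (w_perm : perm_eq w (iota 1 k.+1)) (p : 'S_n) :
  reflect (exists x : 'I_k.+1 -> 'I_n,
    (forall i j : 'I_k.+1, i < j -> x i < x j) /\
    (forall i j : 'I_k.+1, (p (x i) < p (x j)) = ((nth 0 w i).-1 < (nth 0 w j).-1)))
  (contains p (word_perm w_perm)).
Proof.
apply: (iffP existsP) => [[f /andP[/forallP incf /forallP eqf]]|[x [incx eqx]]].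
  exists f; split=> i j; first by move/forallP: (incf i) => /(_ j) /implyP.
  by move/forallP: (eqf i) => /(_ j) /eqP; rewrite !word_perm_val.
exists (finfun x); apply/andP; split; apply/forallP=> i; apply/forallP=> j.
  by rewrite !ffunE; apply/implyP/incx.
by rewrite !ffunE eqx !word_perm_val.
Qed.

(** * Pattern occurrences as inequalities *)

Section Containment.
Variables (n : nat) (p : 'S_n).

Lemma contains1234P :
  reflect (exists a b c d : 'I_n,
    [/\ a < b < c, c < d, p a < p b < p c & p c < p d]) (contains p p1234).
Proof.
apply: (iffP (contains_wordP _ _)) => [[x [incx eqx]]|].
  exists (x (inord 0)), (x (inord 1)), (x (inord 2)), (x (inord 3)).
  by rewrite !incx ?eqx ?inordK.
move=> [a [b [c [d [/andP[ab bc] cd /andP[pab pbc] pcd]]]]].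
exists (fun i => nth a [:: a; b; c; d] i); split.
  by move=> [[|[|[|[|?]]]] ?] [[|[|[|[|?]]]] ?] //=; lia.
by move=> [[|[|[|[|?]]]] ?] [[|[|[|[|?]]]] ?] //=; lia.
Qed.

Lemma contains1324P :
  reflect (exists a b c d : 'I_n,
    [/\ a < b < c, c < d, p a < p c < p b & p b < p d]) (contains p p1324).
Proof.
apply: (iffP (contains_wordP _ _)) => [[x [incx eqx]]|].
  exists (x (inord 0)), (x (inord 1)), (x (inord 2)), (x (inord 3)).
  by rewrite !incx ?eqx ?inordK.
move=> [a [b [c [d [/andP[ab bc] cd /andP[pab pbc] pcd]]]]].
exists (fun i => nth a [:: a; b; c; d] i); split.
  by move=> [[|[|[|[|?]]]] ?] [[|[|[|[|?]]]] ?] //=; lia.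
by move=> [[|[|[|[|?]]]] ?] [[|[|[|[|?]]]] ?] //=; lia.
Qed.

Lemma contains3416725P :
  reflect (exists a b c d e f g : 'I_n,
    [/\ [/\ a < b < c, c < d < e & e < f < g],
        p c < p f < p a, p a < p b < p g & p g < p d < p e])
    (contains p p3416725).
Proof.
apply: (iffP (contains_wordP _ _)) => [[x [incx eqx]]|].
  exists (x (inord 0)), (x (inord 1)), (x (inord 2)), (x (inord 3)),
         (x (inord 4)), (x (inord 5)), (x (inord 6)).
  by rewrite !incx ?eqx ?inordK.
move=> [a [b [c [d [e [f [g [[h1 h2 h3] h4 h5 h6]]]]]]]].
case/andP: h1 h2 h3 h4 h5 h6 => ? ? /andP[? ?] /andP[? ?] /andP[? ?] /andP[? ?] /andP[? ?].
exists (fun i => nth a [:: a; b; c; d; e; f; g] i); split.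
  by move=> [[|[|[|[|[|[|[|?]]]]]]] ?] [[|[|[|[|[|[|[|?]]]]]]] ?] //=; lia.
by move=> [[|[|[|[|[|[|[|?]]]]]]] ?] [[|[|[|[|[|[|[|?]]]]]]] ?] //=; lia.
Qed.

End Containment.

(** * One-sided records *)

Section Records.
Variables (n : nat) (f : 'I_n -> 'I_n).
Hypothesis f_inj : injective f.
Implicit Types p t : 'S_n.

(* [f] is either the identity or [rev_ord]: the records are the left-to-right *)
(* minima in the first case and the right-to-left maxima in the second.       *)
Definition record p (i : 'I_n) :=
  [forall j, (f j < f i) ==> (f (p i) < f (p j))].

Definition records p := [ffun i => if record p i then Some (p i) else None].

Lemma recordP p i :
  reflect (forall j, f j < f i -> f (p i) < f (p j)) (record p i).
Proof. by apply: (iffP forallP) => h j; apply/implyP/h. Qed.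

Lemma record_le p i :
  exists j, [/\ record p j, f j <= f i & f (p j) <= f (p i)].
Proof.
case: (@arg_minnP _ i (fun j => f j <= f i) (fun j => f (p j))) => // j ji jmin.
exists j; split=> //; last exact: jmin.
apply/recordP=> k kj; rewrite ltn_neqAle jmin ?andbT; last by lia.
apply: contraTneq kj => /val_inj /f_inj /perm_inj ->; by rewrite ltnn.
Qed.

Lemma record_lt p i : ~~ record p i ->
  exists j, [/\ record p j, f j < f i & f (p j) < f (p i)].
Proof.
move=> nri; have [j [rj ji pji]] := record_le p i; exists j.
have nij : j != i by apply: contraNneq nri => <-.
split=> //; rewrite ltn_neqAle ?ji ?pji andbT.
  by apply: contra_neq nij => /val_inj /f_inj.
by apply: contra_neq nij => /val_inj /f_inj /perm_inj.
Qed.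

(** A record of [p] cannot meet the hypothesis, so it is unchanged in [t]. Descending from [a] to a
    record thus gives a bound that is an entry of both permutations, which makes the hypothesis
    symmetric. *)
Lemma eq_records p t :
    (forall i, p i != t i ->
       exists a, [/\ f a < f i, f (p a) < f (p i) & f (p a) < f (t i)]) ->
  records p = records t.
Proof.
move=> lowp.
have low i : p i != t i ->
    exists a, [/\ record p a, p a = t a, f a < f i,
                  f (p a) < f (p i) & f (p a) < f (t i)].
  move=> /lowp[b [bi pbi tbi]]; have [a [ra ab pab]] := record_le p b.
  exists a; split=> //; try lia.
  apply/eqP; apply: contraTT ra => /lowp[c [ca pca _]].
  by apply/negP => /recordP/(_ c ca); lia.
have rec_eq i : record p i -> p i = t i.
  move=> ri; apply/eqP; apply: contraTT ri => /lowp[c [ci pci _]].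
  by apply/negP => /recordP/(_ c ci); lia.
have rec_eqt i : record t i -> p i = t i.
  move=> ri; apply/eqP; apply: contraTT ri => /low[c [_ e ci _ pci]].
  by apply/negP => /recordP/(_ c ci); rewrite -e; lia.
have same i : record p i = record t i.
  apply/recordP/recordP => ri j ji.
    rewrite -(rec_eq i); last exact/recordP.
    have [<-|/low[a [_ _ aj _ taj]]] := eqVneq (p j) (t j); first exact: ri.
    by apply: ltn_trans taj; apply: ri; lia.
  rewrite (rec_eqt i); last exact/recordP.
  have [->|/low[a [_ e aj paj _]]] := eqVneq (p j) (t j); first exact: ri.
  by apply: ltn_trans paj; rewrite e; apply: ri; lia.
by apply/ffunP=> i; rewrite !ffunE -same; case: ifP => // /rec_eq ->.
Qed.

(** Such an [i] is a record of neither permutation, so each has a record bounding its own value.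
    Records are common entries, and the lower of the two bounds both values. *)
Lemma records_low p t i : records p = records t -> p i != t i ->
  exists a, [/\ f a < f i, p a = t a, f (p a) < f (p i) & f (p a) < f (t i)].
Proof.
move=> /ffunP e.
have rec_eq j : record p j || record t j -> p j = t j.
  by have := e j; rewrite !ffunE; do 2 case: ifP => //= _; move=> [->].
move=> neq.
have : ~~ (record p i || record t i) by apply: contra_neqN neq => /rec_eq.
rewrite negb_or => /andP[/record_lt[a [ra ai pai]] /record_lt[b [rb bi tbi]]].
have eb : p b = t b by apply: rec_eq; rewrite rb orbT.
have ea : p a = t a by apply: rec_eq; rewrite ra.
have [ab|ba] := leqP (f (p a)) (f (p b)).
  by exists a; split=> //; apply: leq_ltn_trans ab _; rewrite eb.
by exists b; split=> //; [lia | rewrite eb].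
Qed.

End Records.

(** * Frames and the sandwich criterion *)

Section Frame.
Variable n : nat.
Implicit Types p t : 'S_n.

Definition frame p := (records id p, records (@rev_ord n) p).

Lemma rev_ord_ltn (i j : 'I_n) : (rev_ord i < rev_ord j) = (j < i).
Proof. by have := ltn_ord i; have := ltn_ord j; rewrite /=; lia. Qed.

Lemma eq_frame p t :
    (forall i, p i != t i -> exists a c : 'I_n,
       [/\ a < i < c, p a < p i < p c & p a < t i < p c]) ->
  frame p = frame t.
Proof.
move=> sand; congr pair.
  apply: (eq_records (@inj_id _)) => i /sand[a [c]].
  by move=> [/andP[? _] /andP[? _] /andP[? _]]; exists a.
apply: (eq_records (@rev_ord_inj n)) => i /sand[a [c]].
move=> [/andP[_ ?] /andP[_ ?] /andP[_ ?]]; exists c.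
by rewrite !rev_ord_ltn.
Qed.

Lemma frame_sandwich p t i : frame p = frame t -> p i != t i ->
  exists a c : 'I_n, [/\ a < i < c, p a = t a, p c = t c,
    p a < p i < p c & p a < t i < p c].
Proof.
move=> [e1 e2] neq.
have [a [ai ea pa ta]] := records_low (@inj_id _) e1 neq.
have [c [ci ec pc tc]] := records_low (@rev_ord_inj n) e2 neq.
move: ci pc tc; rewrite !rev_ord_ltn => ci pc tc.
by exists a, c; split=> //; apply/andP.
Qed.

Lemma first_difference p t : p != t ->
  exists2 v, (p^-1)%g v != (t^-1)%g v &
             forall u : 'I_n, u < v -> (p^-1)%g u = (t^-1)%g u.
Proof.
move=> neq; have [v0 v0P] : exists v, (p^-1)%g v != (t^-1)%g v.
  apply/existsP; apply: contraNT neq; rewrite negb_exists => /forallP e.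
  by apply/eqP/invg_inj/permP => v; apply/eqP; have := e v; rewrite negbK.
case: (@arg_minnP _ v0 (fun v => (p^-1)%g v != (t^-1)%g v) val) => // v vP vmin.
exists v => // u uv; apply/eqP; apply: contraTT uv => /vmin.
by rewrite -leqNgt.
Qed.

(** * Uniqueness: patterns forced at the least displaced value *)

Section Difference.
Variables (p t : 'S_n) (v : 'I_n).
Hypothesis eq_frame_pt : frame p = frame t.
Hypothesis eq_below : forall u : 'I_n, u < v -> (p^-1)%g u = (t^-1)%g u.
Local Notation x := ((p^-1)%g v).
Local Notation y := ((t^-1)%g v).
Hypothesis lt_yx : y < x.

Let px : p x = v. Proof. exact: permKV. Qed.
Let ty : t y = v. Proof. exact: permKV. Qed.
Let neq_yx : y != x. Proof. by apply: contraTneq lt_yx => ->; rewrite ltnn. Qed.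

(** A value below [v] has the same position in [p] and [t], but [t] has [v] itself at [y]. *)
Let gt_py : v < p y.
Proof.
rewrite ltnNge leq_eqVlt negb_or -leqNgt; apply/andP; split.
  by apply: contra_neq neq_yx => /val_inj e; apply: (@perm_inj _ p); rewrite px.
rewrite leqNgt; apply/negP => /[dup] lt /eq_below; rewrite permK => e.
by have e' := perm_inj e; rewrite -e' ltnn in lt.
Qed.

Let gt_tx : v < t x.
Proof.
rewrite ltnNge leq_eqVlt negb_or -leqNgt; apply/andP; split.
  by apply: contra_neq neq_yx => /val_inj e; apply: (@perm_inj _ t); rewrite ty.
rewrite leqNgt; apply/negP => /[dup] lt /eq_below; rewrite permK => e.
by have e' := perm_inj e; rewrite e' ltnn in lt.
Qed.

Let neq_x : p x != t x.
Proof. by apply: contraTneq gt_tx => <-; rewrite px ltnn. Qed.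

Let neq_y : p y != t y.
Proof. by apply: contraTneq gt_py => ->; rewrite ty ltnn. Qed.

Lemma difference_contains1234 : contains t p1234.
Proof.
have [a [_ [/andP[ay _] ea _ _ /andP[pa _]]]] := frame_sandwich eq_frame_pt neq_y.
have [_ [c [/andP[_ xc] _ ec _ /andP[_ pc]]]] := frame_sandwich eq_frame_pt neq_x.
apply/contains1234P; exists a, y, x, c.
by rewrite -ea -ec; split=> //; apply/andP; split=> //; rewrite ty.
Qed.

Lemma difference_contains : contains p p1324 || contains p p3416725.
Proof.
have [a [c [/andP[ay yc] _ _ /andP[_ pyc] /andP[pa _]]]] :=
  frame_sandwich eq_frame_pt neq_y.
rewrite ty in pa.
have [_ [d0 [/andP[_ xd0] _ _ _ _]]] := frame_sandwich eq_frame_pt neq_x.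
(* [d] will be the 4 of a 1324 or the 5 of a 3416725. *)
case: (@arg_maxnP _ d0 (fun d => x < d) (fun d => p d)) => // d xd dmax.
have after (j : 'I_n) : x <= j -> p j != t j -> p j < p d /\ t j < p d.
  move=> xj /(frame_sandwich eq_frame_pt)[b [e [/andP[_ je] _ _]]].
  move=> /andP[_ pje] /andP[_ tje].
  by have := dmax e (leq_ltn_trans xj je); lia.
have [vd _] := after x (leqnn _) neq_x; rewrite px in vd.
(* [p] and [t] take equally many values at the positions from [x] on, and of  *)
(* these two sets of values only the first contains [v].                      *)
have [j xj rx] : exists2 j : 'I_n, x <= j & (p^-1)%g (t j) < x.
  pose S := [set j : 'I_n | x <= j].
  have : ~~ (t @: S \subset p @: S).
    apply/negP => sub; have /eqP e : t @: S == p @: S.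
      by rewrite eqEcard sub !(card_imset _ (@perm_inj _ _)) /=.
    have : v \in p @: S by apply/imsetP; exists x; rewrite ?inE ?px.
    rewrite -e => /imsetP[i]; rewrite inE => xi vi.
    by move: xi; rewrite leqNgt -(permK t i) -vi lt_yx.
  case/subsetPn => u /imsetP[j]; rewrite inE => xj -> nin; exists j => //.
  rewrite ltnNge; apply: contra nin => xr.
  by apply/imsetP; exists ((p^-1)%g (t j)); rewrite ?inE ?permKV.
set r := (p^-1)%g (t j) in rx; have pr : p r = t j by exact: permKV.
have neq_j : p j != t j.
  by apply: contraTneq rx => e; rewrite /r -e permK -leqNgt.
have neq_r : p r != t r.
  rewrite pr; apply: contraTneq rx => /perm_inj <-; by rewrite -leqNgt.
have vu : v < p r.
  rewrite pr ltnNge leq_eqVlt negb_or; apply/andP; split.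
    apply: contraTneq xj => /val_inj e; rewrite -ltnNge.
    by rewrite -(permK t j) e.
  apply/negP => /eq_below; rewrite permK => e.
  by move: rx; rewrite /r e ltnNge xj.
have ud : p r < p d by rewrite pr; case: (after j xj neq_j).
(* Either [y] and [x] are the middle of a 1324, or [p y] exceeds all values of [p] from [x] on,
   which forces [c] to lie before [x]. *)
have [yd|dy] := ltnP (p y) (p d).
  apply/orP; left; apply/contains1324P; exists a, y, x, d.
  by rewrite px; split=> //; apply/andP; split.
have lt_dy : p d < p y.
  rewrite ltn_neqAle dy andbT; apply/negP => /eqP/val_inj/perm_inj e.
  by move: xd lt_yx; rewrite e; lia.
have cx : c < x.
  rewrite ltnNge leq_eqVlt negb_or; apply/andP; split.
    by apply: contraTneq pyc => /val_inj <-; rewrite px; lia.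
  by apply/negP => /dmax; lia.
have [m [? [/andP[mr _] _ _ /andP[pmr _] _]]] :=
  frame_sandwich eq_frame_pt neq_r.
(* If neither [m] nor [a] yields such a [b], then [p m] is above [v] and [a] lies right of [r], as a
   3416725 requires. *)
have low1324 (b : 'I_n) : b < r -> p b < v -> contains p p1324.
  move=> br pb; apply/contains1324P; exists b, r, x, d.
  by rewrite px br rx pb vu.
have [pmv|vpm] := ltnP (p m) v; first by rewrite (low1324 m).
have [ar|ra] := ltnP a r; first by rewrite (low1324 a).
apply/orP; right; apply/contains3416725P; exists m, r, a, y, c, x, d.
have {}ra : r < a.
  rewrite ltn_neqAle ra andbT; apply: contraTneq vu => /val_inj ->.
  by rewrite -leqNgt ltnW.
have {}vpm : v < p m.
  rewrite ltn_neqAle vpm andbT -px; apply/negP => /eqP/val_inj/perm_inj e.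
  by move: mr rx; rewrite -e; lia.
by rewrite px; split=> //; [split|..]; apply/andP.
Qed.

End Difference.

Lemma frame_inj_in (A : {set 'S_n}) :
    (forall p t (v : 'I_n), p \in A -> t \in A -> frame p = frame t ->
       (forall u : 'I_n, u < v -> (p^-1)%g u = (t^-1)%g u) ->
       ~~ ((t^-1)%g v < (p^-1)%g v)) ->
  {in A &, injective frame}.
Proof.
move=> nlt p t pA tA e; apply/eqP; apply: contraT => /first_difference[v].
rewrite -val_eqE neq_ltn => /orP[lt|lt] below.
  by have := nlt t p v tA pA (esym e) (fun u h => esym (below u h)); rewrite lt.
by have := nlt p t v pA tA e below; rewrite lt.
Qed.

Lemma card_frame_transversal (A : {set 'S_n}) :
    {in A &, injective frame} ->
    (forall p, exists2 t, t \in A & frame t = frame p) ->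
  #|A| = #|frame @: [set: 'S_n]|.
Proof.
move=> injA exA; rewrite -(card_in_imset injA).
apply: eq_card => k; apply/imsetP/imsetP => [[t _ ->]|[p _ ->]].
  by exists t; rewrite ?inE.
by have [t tA e] := exA p; exists t.
Qed.

(** * Existence: extremal weight within a frame *)

(* The base [n.+1] exceeds every position, so moving a small value to the     *)
(* left outweighs moving any single larger value to the right.                *)
Definition weight p := \sum_(i < n) i * n.+1 ^ (n - p i).

Lemma weight_tperm p (b c : 'I_n) : b < c -> p c < p b ->
  weight (tperm b c * p)%g < weight p.
Proof.
move=> bc pcb; have ncb : c != b by rewrite -val_eqE /=; lia.
have split_weight q : weight q = b * n.+1 ^ (n - q b) + c * n.+1 ^ (n - q c) +
    \sum_(i < n | (i != b) && (i != c)) i * n.+1 ^ (n - q i).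
  by rewrite /weight (bigD1 b) //= (bigD1 c) //= addnA.
rewrite !split_weight !permM tpermL tpermR.
rewrite (eq_bigr (fun i : 'I_n => i * n.+1 ^ (n - p i))); last first.
  by move=> i /andP[ib ic]; rewrite permM tpermD // eq_sym.
rewrite ltn_add2r.
have : n.+1 ^ (n - p b) < n.+1 ^ (n - p c).
  by rewrite ltn_exp2l; have := ltn_ord (p b); have := ltn_ord b; lia.
by move: (_ ^ _) (_ ^ _) => B C; nia.
Qed.

(** The new entries at [b], [d], [f] are [p d], [p f], [p b]. Only [p b] moves right, and the
    leftward move of the smaller [p f] outweighs it. *)
Lemma weight_3cycle p (b d f : 'I_n) : b < d < f -> p f < p b < p d ->
  weight (tperm b d * tperm b f * p)%g < weight p.
Proof.
move=> /andP[bd df] /andP[pfb pbd].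
have ndb : d != b by rewrite -val_eqE /=; lia.
have nfb : f != b by rewrite -val_eqE /=; lia.
have nfd : f != d by rewrite -val_eqE /=; lia.
have nbd : b != d by rewrite eq_sym.
have nbf : b != f by rewrite eq_sym.
have ndf : d != f by rewrite eq_sym.
have split_weight q : weight q = b * n.+1 ^ (n - q b) + d * n.+1 ^ (n - q d) +
    f * n.+1 ^ (n - q f) +
    \sum_(i < n | (i != b) && (i != d) && (i != f)) i * n.+1 ^ (n - q i).
  by rewrite /weight (bigD1 b) //= (bigD1 d) //= (bigD1 f) ?nfb //= !addnA.
rewrite !split_weight !permM tpermL tpermR tpermL.
rewrite (tpermD nbf ndf) (tpermD nbd nfd) tpermR.
rewrite (eq_bigr (fun i : 'I_n => i * n.+1 ^ (n - p i))); last first.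
  by move=> i /andP[/andP[ib id] if_]; rewrite !permM !tpermD // eq_sym.
rewrite ltn_add2r.
have : n.+1 * n.+1 ^ (n - p b) <= n.+1 ^ (n - p f).
  by rewrite -expnS leq_exp2l; have := ltn_ord (p b); have := ltn_ord b; lia.
have : n.+1 ^ (n - p d) <= n.+1 ^ (n - p b).
  by rewrite leq_exp2l; have := ltn_ord b; lia.
have : 0 < n.+1 ^ (n - p b) by rewrite expn_gt0.
move: (n.+1 ^ _) (n.+1 ^ _) (n.+1 ^ _) (ltn_ord f) => B D F; nia.
Qed.

(** The order of [p b] and [p c] is left open so as to cover both 1234 and 1324. *)
Lemma frame_tperm p (a b c d : 'I_n) : a < b < c -> c < d ->
    p a < p b < p d -> p a < p c < p d ->
  frame (tperm b c * p)%g = frame p.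
Proof.
move=> /andP[ab bc] cd pb pc; symmetry; apply: eq_frame => i.
rewrite permM; case: tpermP => [->|->|_ _]; last by rewrite eqxx.
  by exists a, d; split=> //; lia.
by exists a, d; split=> //; lia.
Qed.

(** The entries 4, 6, 2 of the 3416725 rotate; 3 and 1 bound them from the lower left, 7 and 5 from
    the upper right. *)
Lemma frame_3cycle p (a b c d e f g : 'I_n) :
    [/\ a < b < c, c < d < e & e < f < g] ->
    p c < p f < p a -> p a < p b < p g -> p g < p d < p e ->
  frame (tperm b d * tperm b f * p)%g = frame p.
Proof.
move=> [? ? ?] ? ? ?.
have nbd : b != d by rewrite -val_eqE /=; lia.
have nbf : b != f by rewrite -val_eqE /=; lia.
have ndf : d != f by rewrite -val_eqE /=; lia.
have nfd : f != d by rewrite eq_sym.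
symmetry; apply: eq_frame => i; rewrite !permM.
have [->|nib] := eqVneq i b.
  by rewrite tpermL (tpermD nbd nfd); exists a, e; split=> //; lia.
have [->|nid] := eqVneq i d.
  by rewrite tpermR tpermL; exists c, e; split=> //; lia.
rewrite (@tpermD _ b d i) 1?eq_sym //.
have [->|nif] := eqVneq i f.
  by rewrite tpermR; exists c, g; split=> //; lia.
by rewrite tpermD ?eqxx 1?eq_sym.
Qed.

Lemma exists_avoider1234 p :
  exists2 t, avoids t p1234 & frame t = frame p.
Proof.
case: (@arg_maxnP _ p (fun t => frame t == frame p) weight) => // t /eqP e tmax.
exists t => //; apply/negP => /contains1234P[a [b [c [d]]]].
move=> [/andP[ab bc] cd /andP[pab pbc] pcd].
have : weight t < weight (tperm b c * t)%g.
  (* [t] is the swapped permutation swapped back, a move that lowers the weight. *)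
  rewrite -[t in ltnLHS](mulKg (tperm b c)) tpermV.
  by apply: weight_tperm => //; rewrite !permM tpermL tpermR.
rewrite ltnNge (tmax : forall u, _ -> weight u <= weight t) // -e.
by apply/eqP/(@frame_tperm t a b c d); lia.
Qed.

Lemma exists_avoider1324_3416725 p :
  exists2 t, avoids t p1324 && avoids t p3416725 & frame t = frame p.
Proof.
case: (@arg_minnP _ p (fun t => frame t == frame p) weight) => // t /eqP e tmin.
exists t => //; apply/andP; split; apply/negP.
  move=> /contains1324P[a [b [c [d [h1 h2 h3 h4]]]]].
  have : weight (tperm b c * t)%g < weight t by apply: weight_tperm; lia.
  by rewrite ltnNge tmin // -e; apply/eqP/(@frame_tperm t a b c d); lia.
move=> /contains3416725P[a [b [c [d [e' [f [g [h1 h2 h3 h4]]]]]]]].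
have : weight (tperm b d * tperm b f * t)%g < weight t.
  by case: h1 => *; apply: weight_3cycle; lia.
by rewrite ltnNge tmin // -e; apply/eqP/(frame_3cycle h1).
Qed.

End Frame.

Theorem theorem1p1 :
  wilf_equivalent [:: Pattern p1324; Pattern p3416725] [:: Pattern p1234].
Proof.
move=> n; rewrite !card_frame_transversal //.
- apply: frame_inj_in => p t v _; rewrite inE /= andbT => tA e below.
  by apply: contra tA; apply: difference_contains1234 e below.
- move=> p; have [t tA e] := exists_avoider1234 p.
  by exists t; rewrite // inE /= andbT.
- apply: frame_inj_in => p t v; rewrite inE /= andbT => pA _ e below.
  move: pA; rewrite -negb_or; apply: contra.
  exact: difference_contains e below.
- move=> p; have [t tA e] := exists_avoider1324_3416725 p.
  by exists t; rewrite // inE /= andbT.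
Qed.
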